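(* Let $A$ be the stiffness matrix of the piecewise linear finite element discretization, on a shape regular simplicial mesh $\mathcal{T}_h$ of $\Omega\subset\mathbb{R}^d$, of $-\nabla\cdot(a(x)\nabla u)=f$ in $\Omega$ with the pure Neumann boundary condition $(a\nabla u)\cdot n=0$ on $\partial\Omega$. Let $A_+$ be defined by $$(A_+u,v)=\sum_{e=(i,j)\in\mathcal{E}^+}\omega_e(u_i-u_j)(v_i-v_j).$$ Then $A_+$ is an $M$-matrix relative of $A$ which is spectrally equivalent to $A$, i.e. there are constants $c_1,c_2>0$ with $c_1\|u\|_A^2\le\|u\|_{A_+}^2\le c_2\|u\|_A^2$ for all $u$. The constants of equivalence depend only on the shape regularity of the mesh. Moreover, the graph corresponding to $A_+$ (vertices: mesh vertices; edges: $\mathcal{E}^+$) is connected.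
   Context: $\Omega\subset\mathbb{R}^d$, $d\in\{1,2,3\}$, is a bounded connected domain partitioned into simplices $\Omega=\cup_{T\in\mathcal{T}_h}T$ (conforming triangulation). The coefficient $a(x)$ is scalar valued with $\alpha_0\le a(x)\le\alpha_1$ for some positive constants $\alpha_0,\alpha_1$, and its discontinuities are aligned with the partition. $A=(a_{ij})$, $a_{ij}=\int_\Omega a(x)\nabla\phi_j\cdot\nabla\phi_i$, where $\{\phi_i\}$ is the nodal basis of continuous piecewise linear functions (all mesh vertices are degrees of freedom). $\mathcal{E}$ is the set of edges $e=(i,j)$ of the triangulation and $\omega_e=-a_{ij}$; thus $(Au,v)=\sum_{e\in\mathcal{E}}\omega_e\delta_eu\,\delta_ev$ with $\delta_eu=u_i-u_j$. It is assumed that constants are the only functions in the null space of this form. $\mathcal{E}^-$ is the set of edges with $a_{ij}\ge0$ and $\mathcal{E}^+=\mathcal{E}\setminus\mathcal{E}^-$. Shape regularity: for $T\in\mathcal{T}_h$ let $\overline h_T=\mathrm{diam}(T)$, $h_T=|T|^{1/d}$, $\underline h_T=2\sup\{r>0:B(x,r)\subset T\text{ for some }x\in T\}$; the mesh is shape regular if there is a uniformly bounded constant $\sigma\ge1$ (the shape regularity constant) with $\underline h_T\le h_T\le\overline h_T\le\sigma\underline h_T$ for all $T$. A symmetric matrix is called here an $M$-matrix if its diagonal entries are positive, its off-diagonal entries are $\le0$, and it is positive semi-definite. $A_M$ is an $M$-matrix relative of $A$ if $A_M$ is an $M$-matrix and $(v,v)_{A_M}\lesssim(v,v)_A$, $(v,v)_D\lesssim(v,v)_{D_M}$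 for all $v$, where $D,D_M$ are the diagonals of $A,A_M$ and $(u,v)_M=(Mu,v)$, $\|v\|_M^2=(v,v)_M$; here the constants hidden in $\lesssim$ depend only on the shape regularity of the mesh. *)

(* Defs.v *)
From HB Require Import structures.
From mathcomp Require Export all_boot all_order all_algebra.
From mathcomp Require Export all_classical all_reals all_analysis.
From mathcomp Require Import ring.
Export Order.TTheory GRing.Theory Num.Theory.
Export numFieldNormedType.Exports.

Set Implicit Arguments.
Unset Strict Implicit.
Unset Printing Implicit Defensive.

#[global] Open Scope classical_set_scope.
#[global] Open Scope ring_scope.

(* The library has Lebesgue measure on [R] and product sigma-algebras on tuples,
   but no Lebesgue measure on R^d. It is built here by recursion on d as the
   image of the product measure under (x, t) |-> x :: t. *)
Section LebesgueTuple.
Variable R : realType.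
Local Notation RT := (measurableTypeR R).

Definition cons_pair d (p : RT * d.-tuple RT) : d.+1.-tuple RT :=
  [tuple of p.1 :: p.2].

Lemma measurable_cons_pair d : measurable_fun setT (@cons_pair d).
Proof. exact: measurable_cons. Qed.

Section Step.
Variables (d : nat) (mu : {sigma_finite_measure set (d.-tuple RT) -> \bar R}).

Definition leb_step : set (d.+1.-tuple RT) -> \bar R :=
  pushforward (@lebesgue_measure R \x mu)%E (@cons_pair d).

Let mcons := @measurable_cons_pair d.

Let leb_step0 : leb_step set0 = 0%E.
Proof. by rewrite /leb_step /pushforward preimage_set0 measure0. Qed.

Let leb_step_ge0 A : (0 <= leb_step A)%E.
Proof. exact: measure_ge0. Qed.

Let leb_step_sigma_additive : semi_sigma_additive leb_step.
Proof.
move=> F mF tF mUF; rewrite /leb_step /pushforward preimage_bigcup.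
apply: measure_semi_sigma_additive.
- by move=> n; rewrite -[X in measurable X]setTI; exact: mcons.
- apply/trivIsetP => /= i j _ _ ij; rewrite -preimage_setI.
  by move/trivIsetP : tF => /(_ _ _ _ _ ij) ->//; rewrite preimage_set0.
- by rewrite -preimage_bigcup -[X in measurable X]setTI; exact: mcons.
Qed.

HB.instance Definition _ := isMeasure.Build _ _ _
  leb_step leb_step0 leb_step_ge0 leb_step_sigma_additive.

Lemma leb_step_sigma_finite : sigma_finite setT leb_step.
Proof.
have /sigma_finiteP[F [FT ndF Foo]] := sigma_finiteT (@lebesgue_measure R).
have /sigma_finiteP[G [GT ndG Goo]] := sigma_finiteT mu.
pose g (t : d.+1.-tuple RT) : RT * d.-tuple RT := (thead t, [tuple of behead t]).
have gK p : g (cons_pair p) = p.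
  case: p => x t; rewrite /g /cons_pair theadE; congr pair.
  by apply/val_inj.
have mg : measurable_fun setT g.
  apply: measurable_fun_pair; last exact: measurable_behead.
  exact: (@measurable_tnth _ RT d.+1 ord0).
exists (fun k => g @^-1` (F k `*` G k)).
  apply/seteqP; split=> [t _|//].
  have [k _ Fk] : (\bigcup_k F k) (g t).1 by rewrite -FT.
  have [l _ Gl] : (\bigcup_k G k) (g t).2 by rewrite -GT.
  exists (maxn k l) => //; split.
    exact: (subsetPset _ _ (ndF _ _ (leq_maxl k l))).
  exact: (subsetPset _ _ (ndG _ _ (leq_maxr k l))).
move=> k; have [mF Fk] := Foo k; have [mG Gk] := Goo k; split.
  by rewrite -[X in measurable X]setTI; apply: mg => //; exact: measurableX.
rewrite /leb_step /pushforward -comp_preimage.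
rewrite (_ : g \o _ = id) ?preimage_id; last first.
  by apply/funext => p /=; exact: gK.
by rewrite product_measure1E// lte_mul_pinfty// ge0_fin_numE.
Qed.

HB.instance Definition _ :=
  Measure_isSigmaFinite.Build _ _ _ leb_step leb_step_sigma_finite.

End Step.

Fixpoint leb (d : nat) : {sigma_finite_measure set (d.-tuple RT) -> \bar R} :=
  match d with
  | 0 => (@dirac _ (0.-tuple RT) [tuple] R)
  | d'.+1 => (leb_step (leb d'))
  end.

End LebesgueTuple.

Section Euclidean.
Variables (R : realType) (d : nat).
Implicit Types (x y : 'rV[R]_d) (S D : set 'rV[R]_d).

(* The library norm on ['rV[R]_d] is the sup norm: it gives the right topology,
   but distances have to be Euclidean. *)
Definition edot x y : R := \sum_(k < d) x 0 k * y 0 k.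

Definition enorm x : R := Num.sqrt (edot x x).

Definition eball x (r : R) : set 'rV[R]_d := [set y | enorm (y - x) < r].

Definition diam S : R :=
  sup [set r | exists x y, [/\ S x, S y & r = enorm (x - y)]].

Definition in_diam S : R :=
  2 * sup [set r | 0 < r /\ exists2 x, S x & eball x r `<=` S].

Definition row_of (t : d.-tuple (measurableTypeR R)) : 'rV[R]_d :=
  \row_k tnth t k.

Definition vol D : R := fine (leb R d (row_of @^-1` D)).

Definition int_Rd D (f : 'rV[R]_d -> R) : R :=
  \int[leb R d]_(t in row_of @^-1` D) f (row_of t).

Definition grad (f : 'rV[R]_d -> R) x : 'rV[R]_d :=
  \row_k ('D_(delta_mx 0 k) f x : R).

End Euclidean.

Section Mesh.
Variables (R : realType) (d : nat).

Definition conv_hull n (p : 'I_n -> 'rV[R]_d) (T : {set 'I_n}) :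
    set 'rV[R]_d :=
  [set x | exists l : 'I_n -> R,
     [/\ forall i, 0 <= l i, forall i, i \notin T -> l i = 0,
         \sum_i l i = 1 & x = \sum_i l i *: p i]].

Definition affinely_independent n (p : 'I_n -> 'rV[R]_d) (T : {set 'I_n}) :=
  forall l : 'I_n -> R, (forall i, i \notin T -> l i = 0) ->
    \sum_i l i = 0 -> \sum_i l i *: p i = 0 -> forall i, l i = 0.

(* A simplex is given by the set of (indices of) its vertices. By
   [mesh_conforming], two closed simplices meet exactly in the (possibly empty)
   common face spanned by their common vertices. *)
Record mesh := Mesh {
  nv : nat;
  vtx : 'I_nv -> 'rV[R]_d;
  simplices : {set {set 'I_nv}};
  vtx_inj : injective vtx;
  vtx_covered : forall i, exists2 T, T \in simplices & i \in T;
  simplex_card : forall T, T \in simplices -> #|T| = d.+1;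
  simplex_nondegenerate :
    forall T, T \in simplices -> affinely_independent vtx T;
  mesh_conforming : forall T T', T \in simplices -> T' \in simplices ->
    conv_hull vtx T `&` conv_hull vtx T' = conv_hull vtx (T :&: T') }.

Variable Th : mesh.

Definition simplex (T : {set 'I_(nv Th)}) : set 'rV[R]_d :=
  conv_hull (@vtx Th) T.

Definition mesh_union : set 'rV[R]_d :=
  [set x | exists2 T, T \in simplices Th & simplex T x].

Definition triangulates (Omega : set 'rV[R]_d) := closure Omega = mesh_union.

Definition shape_regular (sigma : R) :=
  forall T, T \in simplices Th ->
    let hT := vol (simplex T) `^ d%:R^-1 in
    [/\ in_diam (simplex T) <= hT, hT <= diam (simplex T)
      & diam (simplex T) <= sigma * in_diam (simplex T)].

Definition edge : rel 'I_(nv Th) := fun i j =>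
  (i != j) && [exists T in simplices Th, (i \in T) && (j \in T)].

Definition affine_on (S : set 'rV[R]_d) (f : 'rV[R]_d -> R) :=
  exists (g : 'rV[R]_d) (c : R), forall x, S x -> f x = edot g x + c.

(* These conditions determine [phi i] uniquely on the mesh; its values elsewhere
   are irrelevant. *)
Definition nodal_basis (phi : 'I_(nv Th) -> 'rV[R]_d -> R) :=
  forall i, [/\ {within mesh_union, continuous (phi i)},
    forall T, T \in simplices Th -> affine_on (simplex T) (phi i)
    & forall j, phi i (@vtx Th j) = (i == j)%:R].

(* The classical gradient of [phi i] exists in the interior of each simplex; the
   remaining points of the domain form a Lebesgue-null set. *)
Definition stiffness (Omega : set 'rV[R]_d) (a : 'rV[R]_d -> R)
    (phi : 'I_(nv Th) -> 'rV[R]_d -> R) : 'M[R]_(nv Th) :=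
  \matrix_(i, j) int_Rd Omega
    (fun x => a x * edot (grad (phi j) x) (grad (phi i) x)).

Definition aligned_discontinuities (Omega : set 'rV[R]_d)
    (a : 'rV[R]_d -> R) :=
  forall T, T \in simplices Th -> forall x, Omega x ->
    interior (simplex T) x -> {for x, continuous a}.

Definition Eminus (A : 'M[R]_(nv Th)) : rel 'I_(nv Th) := fun i j =>
  edge i j && (0 <= A i j).

Definition Eplus (A : 'M[R]_(nv Th)) : rel 'I_(nv Th) := fun i j =>
  edge i j && ~~ Eminus A i j.

(* Each edge is counted once, through its orientation [i < j]. *)
Definition Aplus_form (A : 'M[R]_(nv Th)) (u v : 'cV[R]_(nv Th)) : R :=
  \sum_(i < nv Th) \sum_(j < nv Th | (i < j)%N && Eplus A i j)
    (- A i j) * (u i 0 - u j 0) * (v i 0 - v j 0).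

Definition Aplus (A : 'M[R]_(nv Th)) : 'M[R]_(nv Th) :=
  \matrix_(i, j) Aplus_form A (delta_mx j 0) (delta_mx i 0).

End Mesh.

Section Forms.
Variables (R : realType) (n : nat).
Implicit Types (M A AM : 'M[R]_n) (u v : 'cV[R]_n).

Definition ip M u v : R := \sum_i (M *m u) i 0 * v i 0.

Definition sqnorm M v : R := ip M v v.

Definition diag_part M : 'M[R]_n := diag_mx (\row_i M i i).

Definition Mmatrix M :=
  [/\ M^T = M, forall i, 0 < M i i, forall i j, i != j -> M i j <= 0
    & forall v, 0 <= sqnorm M v].

Definition Mmatrix_relative (C C' : R) A AM :=
  [/\ Mmatrix AM, forall v, sqnorm AM v <= C * sqnorm A v
    & forall v, sqnorm (diag_part A) v <= C' * sqnorm (diag_part AM) v].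

Definition null_space_is_constants A :=
  forall u, A *m u = 0 -> exists c : R, u = const_mx c.

End Forms.

Lemma AplusE (R : realType) (d : nat) (Th : mesh R d) (A : 'M[R]_(nv Th))
    (u v : 'cV[R]_(nv Th)) :
  ip (Aplus A) u v = Aplus_form A u v.
Proof.
have delta_sum (w : 'cV[R]_(nv Th)) k :
    \sum_i delta_mx i (0 : 'I_1) k 0 * w i 0 = w k 0.
  rewrite (bigD1 k)//= mxE !eqxx mul1r big1 ?addr0// => i ik.
  by rewrite mxE eq_sym (negbTE ik) mul0r.
rewrite /ip /Aplus_form.
under eq_bigr => i _.
  rewrite mxE mulr_suml.
  under eq_bigr => j _.
    rewrite mxE /Aplus_form mulr_suml mulr_suml.
    under eq_bigr => k _ do rewrite mulr_suml mulr_suml.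
    over.
  rewrite exchange_big/=.
  under eq_bigr => k _ do rewrite exchange_big/=.
  over.
rewrite exchange_big/=; apply: eq_bigr => k _.
rewrite exchange_big/=; apply: eq_bigr => l _.
rewrite -(delta_sum u k) -(delta_sum u l) -(delta_sum v k) -(delta_sum v l).
rewrite -!sumrB mulr_sumr; apply: eq_bigr => i _.
rewrite -mulrA mulr_suml mulr_sumr; apply: eq_bigr => j _.
by rewrite -!mulrBl; ring.
Qed.

(* Main.v *)
(* On a simplex T the gradients g_i of the nodal basis functions are constant, so
   A_ij is the sum over T of m_T (g_i, g_j), where m_T is the integral of the
   coefficient over T, and the energy of u is the sum of m_T |D_T u|^2.  A ball
   inside T forces |g_i| times the inner diameter to be at most 1, so shape
   regularity gives |g_i| |x_i - x_j| <= sigma; since u_i - u_j = (D_T u, x_i - x_j),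
   every edge term a_ij (u_i - u_j)^2 is bounded by sigma^2 times the energy of u on
   the simplices around the edge.  Dropping the edges of E^- only adds such terms:
   A <= A_+ <= (1 + (d+1)^2 sigma^2) A.  The lower bound makes the indicator of a
   connected component of E^+ a vector of zero A-energy, hence constant. *)
Require Import Defs.
From mathcomp Require Import measurable_realfun ring lra.

Set Implicit Arguments.
Unset Strict Implicit.
Unset Printing Implicit Defensive.

(** * Lebesgue measure on tuples *)

Section Lebesgue.
Variable R : realType.
Local Notation RT := (measurableTypeR R).

Lemma itv_ball (x y e : R) : x < y < x + e -> ball y e x.
Proof. by move=> /andP[? ?]; rewrite /ball/= ltr_norml; apply/andP; split; lra. Qed.

(** An open set is the union of the countably many sup-norm balls with rational centre and radius
    1/(n+1) that it contains, and each such ball is a finite intersection of conditions on single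
    coordinates. *)
Lemma measurable_preimage_row_of d (S : set 'rV[R]_d) :
  open S -> measurable (@row_of R d @^-1` S).
Proof.
move=> oS.
pose B (p : 'rV[rat]_d * nat) : set 'rV[R]_d :=
  ball (map_mx (ratr : rat -> R) p.1 : 'rV[R]_d) p.2.+1%:R^-1.
rewrite (_ : _ @^-1` _ =
  \bigcup_p (if `[< B p `<=` S >] then @row_of R d @^-1` B p else set0)); last first.
  apply/seteqP; split=> [t /= St|t [p _]]; last by case: asboolP => // + /=; exact.
  have [e /= e0 eS] := proj1 (nbhs_ballP _ _) (open_nbhs_nbhs (conj oS St)).
  (* Two radii 1/(n+1) must fit below e: one from t to the rational centre, one from the centre to
     any point of the ball. *)
  pose n := Num.bound (2 / e).
  have ne : n.+1%:R^-1 + n.+1%:R^-1 < e.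
    rewrite -mulr2n -[_ *+ 2]mulr_natl ltr_pdivrMr ?ltr0n// [e * _]mulrC -ltr_pdivrMr//.
    apply: lt_le_trans (archi_boundP _) _; first by rewrite divr_ge0 ?ltW.
    by rewrite ler_nat leqnSn.
  have n0 : 0 < n.+1%:R^-1 :> R by rewrite invr_gt0 ltr0n.
  pose x : 'I_d -> R := tnth t.
  have /choice[q qP] (k : 'I_d) : exists q : rat,
      x k < ratr q < x k + n.+1%:R^-1.
    have /rat_in_itvoo[q] : x k < x k + n.+1%:R^-1 by rewrite ltrDl.
    by rewrite in_itv/=; exists q.
  have Bt : B (\row_k q k, n) (row_of t).
    split=> // i k; rewrite !mxE; exact: itv_ball (qP k).
  exists (\row_k q k, n) => //; rewrite asboolT//.
  move=> y By; apply/eS/(le_ball (ltW ne)).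
  exact: ball_triangle (ball_sym Bt) By.
apply: countable_bigcupT_measurable => // p; case: ifP => // _.
rewrite (_ : _ @^-1` _ = \bigcap_(k in [set: 'I_d])
  ((fun t : d.-tuple RT => tnth t k) @^-1`
     ball (ratr (p.1 0 k) : R) p.2.+1%:R^-1)); last first.
  apply/seteqP; split=> [t [_ Bt] k _ /=|t Bt].
    by have := Bt 0 k; rewrite !mxE.
  by split; rewrite ?invr_gt0// => i k; have := Bt k I; rewrite !mxE ord1.
apply: fin_bigcap_measurable => // k _.
rewrite -[X in measurable X]setTI; apply: measurable_tnth => //.
by apply: open_measurable; exact: ball_open.
Qed.

Definition affine d (g : 'rV[R]_d) (c : R) (x : 'rV[R]_d) : R := edot g x + c.

Lemma measurable_affine d (g : 'rV[R]_d) c :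
  measurable_fun setT (affine g c \o @row_of R d).
Proof.
apply: measurable_funD => //=; apply: measurable_sum => k.
apply: measurable_funM => //; under eq_fun do rewrite mxE.
exact: measurable_tnth.
Qed.

Definition hyperplane d (g : 'rV[R]_d) (c : R) : set (d.-tuple RT) :=
  [set t | affine g c (row_of t) = 0].

Lemma measurable_hyperplane d (g : 'rV[R]_d) c : measurable (hyperplane g c).
Proof.
rewrite (_ : hyperplane g c = (affine g c \o @row_of R d) @^-1` [set 0])//.
rewrite -[X in measurable X]setTI; exact: measurable_affine.
Qed.

(** Induction on d, slicing along the first coordinate. If the remaining slope [g'] is nonzero,
    every slice is a null hyperplane; if [g' = 0], the set is one value of the first coordinate
    times the whole space. *)
Lemma leb_hyperplane d (g : 'rV[R]_d) c : g != 0 -> leb R d (hyperplane g c) = 0%E.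
Proof.
elim: d g c => [|d IH] g c; first by move=> /negP[]; apply/eqP/rowP => -[].
move=> g0; rewrite /= /leb_step /pushforward.
pose g' : 'rV[R]_d := \row_k g 0 (lift ord0 k).
have consE x t : affine g c (row_of (cons_pair (x, t))) =
    affine g' (g 0 ord0 * x + c) (row_of t).
  rewrite /affine /edot big_ord_recl !mxE (tnth_nth 0)/= addrAC addrC.
  by congr (_ + _); apply: eq_bigr => k _; rewrite !mxE !(tnth_nth 0).
have [g'0|g'0] := eqVneq g' 0; last first.
  rewrite /product_measure1; apply: integral0_eq => x _ /=.
  rewrite -[RHS](IH _ (g 0 ord0 * x + c) g'0); congr (leb R d _).
  by apply/seteqP; split=> t; rewrite /xsection/= /hyperplane/= inE/= consE.
have g00 : g 0 ord0 != 0.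
  apply: contra_neq g0 => g00; apply/rowP => k; rewrite mxE.
  by case: (unliftP ord0 k) => [j ->|->//]; have /rowP/(_ j) := g'0; rewrite !mxE.
rewrite (_ : _ @^-1` _ = [set - c / g 0 ord0] `*` setT); last first.
  apply/seteqP; split=> [[x t]|[x t] [/= -> _]]; rewrite /hyperplane/= consE g'0.
    rewrite /affine/edot big1 => [|k _]; last by rewrite mxE mul0r.
    rewrite add0r => /eqP; rewrite addr_eq0 => /eqP gx.
    by split=> //; rewrite -gx mulrAC divff ?mul1r.
  rewrite /affine/edot big1 => [|k _]; last by rewrite mxE mul0r.
  by rewrite mulrCA divff// mulr1 add0r addNr.
rewrite product_measure1E// [X in (X * _)%E](_ : _ = 0%E) ?mul0e//.
exact: lebesgue_measure_set1.
Qed.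

(** The set lies in a cube, and cubes have finite measure by induction on the dimension. *)
Lemma leb_bounded d (S : set 'rV[R]_d) : bounded_set S -> open S ->
  (leb R d (@row_of R d @^-1` S) < +oo)%E.
Proof.
move=> bS oS.
pose box n (M : R) : set (n.-tuple RT) := [set t | forall k, `|tnth t k| <= M].
have mbox n M : measurable (box n M).
  rewrite (_ : box n M = \bigcap_(k in [set: 'I_n])
      ((fun t : n.-tuple RT => tnth t k) @^-1` [set` `[-M, M]])); last first.
    apply/seteqP; split=> [t bt k _ /=|t bt k]; first by rewrite in_itv/= -ler_norml.
    by have := bt k I; rewrite /= in_itv/= -ler_norml.
  apply: fin_bigcap_measurable => // k _.
  by rewrite -[X in measurable X]setTI; apply: measurable_tnth.
have boxfin n M : (leb R n (box n M) < +oo)%E.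
  elim: n => [|n IH] /=; first by rewrite /dirac indicE ltry.
  rewrite /leb_step /pushforward.
  rewrite (_ : _ @^-1` _ = [set` `[-M, M]] `*` box n M); last first.
    apply/seteqP; split=> [[x t] bt|[x t] [/= xM bt] k].
      split=> [|k] /=.
        by have := bt ord0; rewrite (tnth_nth 0)/= in_itv/= -ler_norml.
      by have := bt (lift ord0 k); rewrite !(tnth_nth 0).
    case: (unliftP ord0 k) => [j ->|->]; rewrite (tnth_nth 0)/=; last first.
      by move: xM; rewrite in_itv/= -ler_norml.
    by have := bt j; rewrite (tnth_nth 0).
  rewrite product_measure1E//=; last exact: mbox.
  rewrite lte_mul_pinfty// ge0_fin_numE//= lebesgue_measure_itv/=.
  by case: ifP => // _; rewrite ltry.
have /pinfty_ex_gt0[M M0 SM] := bS.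
apply: le_lt_trans (boxfin d M); apply: le_measure; rewrite ?inE//.
- exact: measurable_preimage_row_of.
- exact: mbox.
move=> t St k; apply: le_trans (SM _ St).
have -> : tnth t k = row_of t 0 k by rewrite mxE.
rewrite [leRHS]mx_normrE.
exact: (le_bigmax _ (fun i : 'I_1 * 'I_d => `|row_of t i.1 i.2|) (0, k)).
Qed.

End Lebesgue.

(** * Integration *)

Section Integral.
Context d (T : measurableType d) (R : realType).
Variable mu : {measure set T -> \bar R}.
Import HBNNSimple.

(* [f] need not be measurable, which rules out [ge0_negligible_integral]: the
   coefficient is arbitrary on the mesh skeleton and [leb] is not complete. *)
Lemma integral_setD_null (D N : set T) (f : T -> \bar R) :
    measurable N -> mu N = 0%E ->
  (\int[mu]_(x in D) f x = \int[mu]_(x in D `\` N) f x)%E.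
Proof.
move=> mN N0.
suff ge0 (g : T -> \bar R) : (forall x, 0 <= g x)%E ->
    (\int[mu]_(x in D) g x = \int[mu]_(x in D `\` N) g x)%E.
  by rewrite integralE [RHS]integralE !ge0// => x; exact: funeneg_ge0.
move=> g0; rewrite !ge0_integralE//=.
have gD0 x : (0 <= (g \_ D) x)%E by exact: erestrict_ge0.
apply/eqP; rewrite eq_le; apply/andP; split; last first.
  apply: le_ereal_sup => _ [h /= hg <-]; exists h => //= x.
  apply: le_trans (hg x) _; rewrite !patchE.
  case: ifPn => [|_]; last by case: ifP.
  by rewrite !inE => -[Dx _]; rewrite mem_set.
apply: ge_ereal_sup => _ [h /= hg <-].
have mCN := measurableC mN.
(* A simple function [h] below g on D is cut off on N; being measurable, [h] keeps its integral when
   the null set N is removed. *)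
apply: ereal_sup_ubound; exists (proj_nnsfun h mCN).
  move=> x /=; rewrite mindicE; have [xN|xN] := boolP (x \in ~` N); last first.
    by rewrite mulr0 erestrict_ge0.
  rewrite mulr1; apply: le_trans (hg x) _; rewrite !patchE.
  case: ifPn => [xD|_]; last by case: ifP.
  by rewrite ifT//; move: xD xN; rewrite !inE.
rewrite -mrestrict -integral_nnsfun// -integralT_nnsfun.
rewrite [RHS](@ge0_negligible_integral _ _ _ _ _ N)//; first by rewrite setTD.
- by apply/measurable_EFinP.
- by move=> x _; rewrite lee_fin.
Qed.

Lemma Rintegral_bigsetU (I : eqType) (F : I -> set T) (f : T -> R) (s : seq I) :
    (forall i, measurable (F i)) -> uniq s -> trivIset [set` s] F ->
    (forall i, i \in s -> mu.-integrable (F i) (EFin \o f)) ->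
  \int[mu]_(x in \big[setU/set0]_(i <- s) F i) f x =
  \sum_(i <- s) \int[mu]_(x in F i) f x.
Proof.
move=> mF us tF intf; rewrite /Rintegral integral_bigsetU_EFin//.
  rewrite big_seq_cond [RHS]big_seq_cond sum_fine// => i; rewrite andbT => /intf.
  by move=> ii; apply: integrable_fin_num.
have {intf} : forall i, i \in s -> measurable_fun (F i) (EFin \o f).
  by move=> i /intf /integrableP[].
elim: s {us tF} => [|i s IH] mf; first by rewrite big_nil; exact: measurable_fun_set0.
rewrite big_cons; apply/measurable_funU => //; first exact: bigsetU_measurable.
by split; [|apply: IH => j js]; apply: mf; rewrite inE ?eqxx ?js ?orbT.
Qed.

End Integral.

(** * The Euclidean inner product and affine functions *)

Section Edot.
Variables (R : realType) (d : nat).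
Implicit Types (x y g : 'rV[R]_d) (c : R).

Lemma edotC x y : edot x y = edot y x.
Proof. by apply: eq_bigr => k _; rewrite mulrC. Qed.

Lemma edotDr x y z : edot x (y + z) = edot x y + edot x z.
Proof. by rewrite -big_split; apply: eq_bigr => k _; rewrite mxE mulrDr. Qed.

Lemma edotZr c x y : edot x (c *: y) = c * edot x y.
Proof. by rewrite mulr_sumr; apply: eq_bigr => k _; rewrite mxE mulrCA. Qed.

Lemma edotBr x y z : edot x (y - z) = edot x y - edot x z.
Proof. by rewrite edotDr -scaleN1r edotZr mulN1r. Qed.

Lemma edot0r x : edot x 0 = 0.
Proof. by rewrite -(scale0r 0) edotZr mul0r. Qed.

Lemma edot_sumr I (r : seq I) (P : pred I) (F : I -> 'rV[R]_d) x :
  edot x (\sum_(i <- r | P i) F i) = \sum_(i <- r | P i) edot x (F i).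
Proof. exact: (big_morph _ (edotDr x) (edot0r x)). Qed.

Lemma edot_ge0 x : 0 <= edot x x.
Proof. by apply: sumr_ge0 => k _; rewrite -expr2 sqr_ge0. Qed.

Lemma edot_eq0 x : (edot x x == 0) = (x == 0).
Proof.
apply/eqP/eqP => [|->]; last exact: edot0r.
move=> /psumr_eq0P x0; apply/rowP => k; rewrite mxE.
by apply/eqP; rewrite -[_ == 0]orbb -mulf_eq0 x0// => j _; rewrite -expr2 sqr_ge0.
Qed.

Lemma edot_delta x k : edot x (delta_mx 0 k) = x 0 k.
Proof.
rewrite /edot (bigD1 k)//= mxE !eqxx mulr1 big1 ?addr0// => j jk.
by rewrite mxE (negbTE jk) andbF mulr0.
Qed.

(** Cauchy-Schwarz: the squared length of (y,y) x - (x,y) y is (y,y) times the right side minus the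
    left side. *)
Lemma edot_sqr_le x y : edot x y ^+ 2 <= edot x x * edot y y.
Proof.
have [->|y0] := eqVneq y 0; first by rewrite !edot0r expr0n mulr0.
have yy : 0 < edot y y by rewrite lt_def edot_eq0 y0 edot_ge0.
rewrite -subr_ge0 -(pmulr_rge0 _ yy).
have := edot_ge0 (edot y y *: x - edot x y *: y).
rewrite !edotBr !edotZr ![edot (_ - _) _]edotC !edotBr !edotZr [edot y x]edotC.
by congr (0 <= _); ring.
Qed.

Lemma enorm_sqr x : enorm x ^+ 2 = edot x x.
Proof. by rewrite sqr_sqrtr// edot_ge0. Qed.

Lemma enorm_ge0 x : 0 <= enorm x.
Proof. exact: sqrtr_ge0. Qed.

Lemma enorm_gt0 x : (0 < enorm x) = (x != 0).
Proof. by rewrite sqrtr_gt0 lt_def edot_eq0 edot_ge0 andbT. Qed.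

Lemma enormZ c x : enorm (c *: x) = `|c| * enorm x.
Proof.
by rewrite /enorm edotZr edotC edotZr mulrA -expr2 sqrtrM ?sqr_ge0// sqrtr_sqr.
Qed.

Lemma affineB g c x y : affine g c x - affine g c y = edot g (x - y).
Proof. by rewrite edotBr /affine opprD addrACA subrr addr0. Qed.

Lemma affine_comb n (p : 'I_n -> 'rV[R]_d) (l : 'I_n -> R) g c :
  \sum_i l i = 1 -> affine g c (\sum_i l i *: p i) = \sum_i l i * affine g c (p i).
Proof.
move=> l1; rewrite /affine edot_sumr -[in LHS](mulr1 c) -l1 mulr_sumr -big_split.
by apply: eq_bigr => i _; rewrite edotZr mulrDr [c * _]mulrC.
Qed.

Lemma continuous_affine g c : continuous (affine g c).
Proof.
have cE : continuous (edot g).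
  apply: continuous_big => [|k _ x]; first exact: add_continuous.
  by apply: cvgMl_tmp; [exact: nbhs_filter|exact: coord_continuous].
by move=> x; exact: (cvgD (cE x) (cvg_cst c)).
Qed.

Lemma grad_affine (f : 'rV[R]_d -> R) g c x :
  (\near x, f x = affine g c x) -> grad f x = g.
Proof.
move=> fg; apply/rowP => k; rewrite mxE (near_eq_derive _ fg).
apply: cvg_lim => //; rewrite -[g 0 k]edot_delta.
apply: cvg_near_cst; near=> h => /=.
rewrite affineB addrK edotZr /GRing.scale/= mulKf//.
by near: h; exact: nbhs_dnbhs_neq.
Unshelve. all: by end_near. Qed.

End Edot.

(** * Barycentric coordinates on a simplex *)

Section Simplex.
Variables (R : realType) (d n : nat).
Variables (p : 'I_n -> 'rV[R]_d) (T : {set 'I_n}).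
Hypotheses (cardT : #|T| = d.+1) (indT : affinely_independent p T).

(** The matrix with rows (1, p_k), k in T, is square because T has d+1 elements. Affine independence
    makes its rows free, so (1, x) is a combination of them. *)
Lemma barycentric_exists (x : 'rV[R]_d) : exists l : 'I_n -> R,
  [/\ forall i, i \notin T -> l i = 0, \sum_i l i = 1 & x = \sum_i l i *: p i].
Proof.
pose M : 'M[R]_(#|T|, 1 + d) := \matrix_k row_mx 1 (p (enum_val k)).
(* [l w] extends weights on T by zero to all indices. *)
pose l (w : 'rV[R]_#|T|) i := \sum_k w 0 k * (enum_val k == i)%:R.
have l0 w i : i \notin T -> l w i = 0.
  move=> iT; rewrite /l big1// => k _; have [ki|] := eqVneq; last by rewrite mulr0.
  by rewrite -ki enum_valP in iT.
have sum_l (V : lmodType R) (F : 'I_n -> V) w :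
    \sum_i l w i *: F i = \sum_k w 0 k *: F (enum_val k).
  under eq_bigr do rewrite scaler_suml.
  rewrite exchange_big/=; apply: eq_bigr => k _.
  rewrite (bigD1 (enum_val k))//= eqxx mulr1 big1 ?addr0// => i ik.
  by rewrite eq_sym (negbTE ik) mulr0 scale0r.
have mulM w : w *m M = row_mx (\sum_i l w i)%:M (\sum_i l w i *: p i).
  rewrite sum_l; have := sum_l R^o (fun=> 1) w; rewrite /GRing.scale/=.
  under eq_bigr do rewrite mulr1; move=> ->.
  have rM k : row k M = row_mx 1 (p (enum_val k)) by apply/rowP => j; rewrite !mxE.
  rewrite mulmx_sum_row; under [LHS]eq_bigr do rewrite rM scale_row_mx.
  apply/rowP => j; rewrite summxE -(fintype.splitK j); case: (fintype.split j) => k /=.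
    rewrite row_mxEl ord1 mxE eqxx mulr1n; apply: eq_bigr => i _.
    by rewrite row_mxEl !mxE.
  rewrite row_mxEr summxE; apply: eq_bigr => i _.
  by rewrite row_mxEr !mxE.
have freeM : row_free M.
  apply: inj_row_free => w; rewrite mulM => w0.
  have lp := congr1 rsubmx w0; rewrite row_mxKr linear0 in lp.
  have := congr1 lsubmx w0; rewrite row_mxKl linear0 => /rowP/(_ 0).
  rewrite !mxE eqxx mulr1n => l1.
  have lw0 := indT (l0 w) l1 lp.
  apply/rowP => k; rewrite mxE -(lw0 (enum_val k)) /l (bigD1 k)//= eqxx mulr1.
  rewrite big1 ?addr0// => j jk; rewrite (inj_eq enum_val_inj) (negbTE jk).
  by rewrite mulr0.
have fullM : row_full M by rewrite -col_leq_rank (eqP freeM) cardT.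
have /submxP[w] := submx_full (row_mx 1 x) fullM.
rewrite mulM => /eq_row_mx[/rowP/(_ 0)]; rewrite !mxE eqxx mulr1n => l1 lx.
by exists (l w); split => //; exact: l0.
Qed.

Variables (g : 'I_n -> 'rV[R]_d) (c : 'I_n -> R).
Hypothesis gc : forall i j, j \in T -> affine (g i) (c i) (p j) = (i == j)%:R.
Local Notation L i := (affine (g i) (c i)).

Lemma barycentric_affine (l : 'I_n -> R) i : (forall j, j \notin T -> l j = 0) ->
  \sum_j l j = 1 -> L i (\sum_j l j *: p j) = l i.
Proof.
move=> l0 l1; rewrite affine_comb// (bigD1 i)//= big1 => [|j ji].
  have [iT|/l0->] := boolP (i \in T); last by rewrite mul0r addr0.
  by rewrite gc// eqxx mulr1 addr0.
have [jT|/l0->] := boolP (j \in T); last by rewrite mul0r.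
by rewrite gc// eq_sym (negbTE ji) mulr0.
Qed.

Lemma affine_barycentric (x : 'rV[R]_d) :
  [/\ forall i, i \notin T -> L i x = 0, \sum_i L i x = 1
    & x = \sum_i L i x *: p i].
Proof.
have [l [l0 l1 lx]] := barycentric_exists x.
have Ll i : L i x = l i by rewrite {1}lx barycentric_affine.
split=> [i iT||]; first by rewrite Ll l0.
- by under eq_bigr do rewrite Ll.
- by under eq_bigr do rewrite Ll.
Qed.

Lemma conv_hullP (x : 'rV[R]_d) : conv_hull p T x <-> forall i, 0 <= L i x.
Proof.
split=> [[l [l_ge0 l0 l1 ->]] i|L0]; first by rewrite barycentric_affine.
have [? ? ?] := affine_barycentric x.
by exists (fun i => L i x).
Qed.

Lemma conv_hull_le1 (x : 'rV[R]_d) i : conv_hull p T x -> L i x <= 1.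
Proof.
move=> /conv_hullP L0; have [_ <- _] := affine_barycentric x.
by rewrite (bigD1 i)//= lerDl sumr_ge0.
Qed.

Lemma gradient_outside i : i \notin T -> g i = 0.
Proof.
move=> iT; apply/rowP => k; rewrite -edot_delta -[delta_mx 0 k]subr0.
have L0 x : L i x = 0 by have [] := affine_barycentric x => /(_ i iT).
by rewrite -(affineB _ (c i)) !L0 subrr mxE.
Qed.

Lemma sum_gradient : \sum_i g i = 0.
Proof.
apply/rowP => k; rewrite -edot_delta -[delta_mx 0 k]subr0 edotC edot_sumr.
under eq_bigr => i _ do rewrite edotC -(affineB _ (c i)).
have [_ Ld _] := affine_barycentric (delta_mx 0 k).
have [_ L0 _] := affine_barycentric 0.
by rewrite sumrB Ld L0 subrr mxE.
Qed.

(** The combined slope is that of the affine interpolant of u on T, so all edge differences of u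
    become inner products with a single vector. *)
Lemma gradient_combination (u : 'I_n -> R) i j : i \in T -> j \in T ->
  edot (\sum_k u k *: g k) (p i - p j) = u i - u j.
Proof.
move=> iT jT; rewrite edotC edot_sumr.
under eq_bigr => k _ do rewrite edotZr edotC -(affineB _ (c k)) !gc// mulrBr.
rewrite sumrB (bigD1 i)//= [X in _ - X](bigD1 j)//= !eqxx !mulr1.
by rewrite !big1 ?addr0// => k /negbTE->; rewrite mulr0.
Qed.

(** Only i in T are tested, since the other coordinates vanish identically. *)
Definition open_simplex : set 'rV[R]_d := [set x | forall i, i \in T -> 0 < L i x].

Lemma open_open_simplex : open open_simplex.
Proof.
rewrite openE => x Lx; rewrite /interior.
have nearL i : \forall y \near x, i \in T -> 0 < L i y.
  have [iT|iT] := boolP (i \in T); last by near=> y.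
  have Li : \forall y \near x, 0 < L i y.
    exact: (cvgr_gt _ (@continuous_affine R d (g i) (c i) x) _ (Lx i iT)).
  by near=> y; move=> _; near: y.
exact: filter_forall nearL.
Unshelve. all: by end_near. Qed.

Lemma open_simplex_sub : open_simplex `<=` conv_hull p T.
Proof.
move=> x Lx; apply/conv_hullP => i.
have [iT|iT] := boolP (i \in T); first exact/ltW/Lx.
by have [/(_ i iT)->] := affine_barycentric x.
Qed.

Lemma vertex_conv_hull i : i \in T -> conv_hull p T (p i).
Proof. by move=> iT; apply/conv_hullP => j; rewrite gc// ler0n. Qed.

(** On the simplex [L i] stays between 0 and 1, while inside a ball of radius r it has oscillation 2
    r |g_i|. *)
Lemma gradient_in_diam i : enorm (g i) * in_diam (conv_hull p T) <= 1.
Proof.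
have [->|g0] := eqVneq (g i) 0.
  by rewrite /enorm edot0r sqrtr0 mul0r ler01.
have n0 : 0 < enorm (g i) by rewrite enorm_gt0.
rewrite -ler_pdivlMl// mulr1 /in_diam -ler_pdivlMl//.
set S := [set r | _].
(* Without an inscribed ball the supremum takes its default value 0. *)
have [->|S0] := eqVneq S set0; first by rewrite sup0 mulr_ge0 ?invr_ge0 ?enorm_ge0.
apply: ge_sup; first exact/set0P.
move=> r [r0 [x Sx xrS]].
(* Moving by s > 1 / (2 |g_i|) along g_i and -g_i would change the barycentric
   coordinate by more than 1. *)
rewrite leNgt; apply/negP => /midf_lt[gs sr]; set s := _ / 2 in gs sr.
pose v := (s / enorm (g i)) *: g i.
have s0 : 0 < s by apply: lt_trans gs; rewrite mulr_gt0 ?invr_gt0.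
have gv : edot (g i) v = s * enorm (g i).
  by rewrite edotZr -enorm_sqr expr2 mulrA mulfVK ?gt_eqF.
have vr : enorm v < r.
  by rewrite enormZ gtr0_norm ?(divr_gt0 s0 n0)// mulfVK ?gt_eqF.
have [Sv Snv] : conv_hull p T (x + v) /\ conv_hull p T (x - v).
  split; apply: xrS; rewrite /eball/= addrAC subrr add0r//.
  by rewrite -scaleN1r enormZ normrN1 mul1r.
have : L i (x + v) - L i (x - v) <= 1.
  by rewrite lerBlDr (le_trans (conv_hull_le1 i Sv))// lerDl; have /conv_hullP := Snv.
rewrite affineB opprB addrC addrA subrK edotDr gv -mulr2n -mulr_natl.
by move: gs; rewrite ltr_pdivrMr// => gs; lra.
Qed.

Lemma edge_le_diam i j : i \in T -> j \in T ->
  enorm (p i - p j) <= diam (conv_hull p T).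
Proof.
move=> iT jT; apply: ub_le_sup; last first.
  by exists (p i), (p j); split => //; exact: vertex_conv_hull.
(* The supremum in [diam] dominates its members only if the distances are bounded above; a
   coordinate of a convex combination is at most the sum of the absolute values at the vertices. *)
have bounded x k : conv_hull p T x -> `|x 0 k| <= \sum_a `|p a 0 k|.
  move=> Sx; have [_ _ ->] := affine_barycentric x; rewrite summxE.
  apply: le_trans (ler_norm_sum _ _ _) _; apply: ler_sum => a _.
  have /conv_hullP/(_ a) L0 := Sx.
  by rewrite mxE normrM ger0_norm// ler_piMl// conv_hull_le1.
exists (Num.sqrt (\sum_(k < d) (\sum_a `|p a 0 k| + \sum_a `|p a 0 k|) ^+ 2)).
move=> _ [x [y [Sx Sy ->]]]; apply: ler_wsqrtr; apply: ler_sum => k _.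
rewrite -expr2 -real_normK ?num_real// ler_sqr ?nnegrE ?addr_ge0 ?sumr_ge0//.
by rewrite !mxE (le_trans (ler_normB _ _))// lerD ?bounded.
Qed.

End Simplex.

(** * Assembly of the stiffness matrix *)

Section Assembly.
Variable R : realType.

(** Within W the preimage of an open interval under [a] is open, which reduces the claim to open
    sets. *)
Lemma measurable_fun_row_of d (W : set 'rV[R]_d) (a : 'rV[R]_d -> R) :
  open W -> (forall x, W x -> {for x, continuous a}) ->
  measurable_fun (@row_of R d @^-1` W) (a \o @row_of R d).
Proof.
move=> oW ca; apply: (measurability _ (RGenOpens.measurableE R)).
move=> _ [_ [u [v ->] <-]].
apply: (@measurable_preimage_row_of _ _ (W `&` a @^-1` [set` `]u, v[])).
rewrite openE => x [Wx ax]; apply: filterI; first exact: open_nbhs_nbhs.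
apply: (ca x Wx); apply: open_nbhs_nbhs; split => //; exact: interval_open.
Qed.

Variables (d : nat) (Th : mesh R d).
Local Notation n := (nv Th).
Local Notation I := 'I_(nv Th).

(** Slope and constant term of each nodal function on each simplex. For i outside T the condition
    forces the zero function. *)
Definition shape_functions (G : {set I} -> I -> 'rV[R]_d) (C : {set I} -> I -> R) :=
  forall T, T \in simplices Th ->
  forall i j, j \in T -> affine (G T i) (C T i) (@vtx _ _ Th j) = (i == j)%:R.

Lemma nodal_basis_shape_functions (phi : I -> 'rV[R]_d -> R) : nodal_basis phi ->
  exists G C, shape_functions G C /\ forall T, T \in simplices Th ->
    forall i x, simplex T x -> phi i x = affine (G T i) (C T i) x.
Proof.
move=> nphi.
have /choice[gc gcP] (Ti : {set I} * I) : exists gc : 'rV[R]_d * R,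
    Ti.1 \in simplices Th -> forall x, simplex Ti.1 x -> phi Ti.2 x = affine gc.1 gc.2 x.
  have [_ aff _] := nphi Ti.2.
  (* The pair (0, 0) is a dummy for sets T that are not in the mesh. *)
  have [/aff[g [c gc]]|_] := boolP (Ti.1 \in simplices Th); last by exists (0, 0).
  by exists (g, c).
exists (fun T i => (gc (T, i)).1), (fun T i => (gc (T, i)).2); split => T TS i.
  move=> j jT; have [_ _ <-] := nphi i.
  rewrite (gcP (T, i))//; exists (fun k => (k == j)%:R).
  split => [k|k||]; first exact: ler0n.
  - by apply: contraNeq; rewrite pnatr_eq0 eqb0 negbK => /eqP->.
  - by rewrite (bigD1 j)//= eqxx big1 ?addr0// => k /negbTE->.
  - rewrite (bigD1 j)//= eqxx scale1r big1 ?addr0// => k /negbTE->.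
    by rewrite scale0r.
exact: (gcP (T, i)).
Qed.

Section ShapeFunctions.
Variables (G : {set I} -> I -> 'rV[R]_d) (C : {set I} -> I -> R).
Hypothesis GC : shape_functions G C.

(** By conformity a common point lies in the hull of the common vertices. Its coordinate at a vertex
    of one simplex missing from the other would be 0, against positivity. *)
Lemma open_simplex_disjoint T T' (x : 'rV[R]_d) :
    T \in simplices Th -> T' \in simplices Th ->
  open_simplex T (G T) (C T) x -> open_simplex T' (G T') (C T') x -> T = T'.
Proof.
have sub T1 T2 : T1 \in simplices Th -> T2 \in simplices Th ->
    open_simplex T1 (G T1) (C T1) x -> open_simplex T2 (G T2) (C T2) x ->
    T1 \subset T2.
  move=> S1 S2 x1 x2; apply/fintype.subsetP => i iT1.
  have : (simplex T1 `&` simplex T2) x.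
    by split; apply: (open_simplex_sub _ _ (GC _)) => //;
      [exact: simplex_card|exact: simplex_nondegenerate
      |exact: simplex_card|exact: simplex_nondegenerate].
  rewrite /simplex mesh_conforming// => -[l [_ l0 l1 xl]].
  apply: contraTT (x1 i iT1) => iT2; rewrite -leNgt xl.
  rewrite (barycentric_affine (GC S1))// => [|j jT1].
    by rewrite l0// inE negb_and iT2 orbT.
  by apply: l0; rewrite inE negb_and jT1.
by move=> *; apply/eqP; rewrite finset.eqEsubset !sub.
Qed.


(** The intersection with [Omega] is kept because [triangulates] identifies only the closure of
    [Omega] with the mesh union. *)
Definition open_element (Omega : set 'rV[R]_d) (T : {set I}) :
    set (d.-tuple (measurableTypeR R)) :=
  @row_of R d @^-1` (Omega `&` open_simplex T (G T) (C T)).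

Definition mesh_skeleton (Omega : set 'rV[R]_d) :=
  @row_of R d @^-1` Omega `\`
    \big[setU/set0]_(T <- enum (simplices Th)) open_element Omega T.

Lemma open_elementW Omega :
  open Omega -> forall T, open (Omega `&` open_simplex T (G T) (C T)).
Proof. by move=> oO T; apply: openI => //; exact: open_open_simplex. Qed.

Lemma measurable_open_element Omega :
  open Omega -> forall T, measurable (open_element Omega T).
Proof. by move=> oO T; apply: measurable_preimage_row_of; exact: open_elementW. Qed.

Lemma measurable_mesh_skeleton Omega :
  open Omega -> measurable (mesh_skeleton Omega).
Proof.
move=> oO; apply: measurableD; first exact: measurable_preimage_row_of.
by apply: bigsetU_measurable => T _; exact: measurable_open_element.
Qed.

(* A boundary point of a simplex lies on the zero hyperplane of a barycentric coordinate. *)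
Lemma leb_mesh_skeleton Omega : open Omega -> triangulates Th Omega ->
  leb R d (mesh_skeleton Omega) = 0%E.
Proof.
move=> oO tO.
apply/negligibleP; first exact: measurable_mesh_skeleton.
(* One hyperplane for each of the countably many pairs (T, i); a zero slope gives no hyperplane, and
   the empty set stands in. *)
pose H (Ti : {set I} * I) := if G Ti.1 Ti.2 == 0 then set0 else
   hyperplane (G Ti.1 Ti.2) (C Ti.1 Ti.2).
apply: (@negligibleS _ _ _ _ (\bigcup_k oapp H set0 (unpickle k))) => [t [Ot nV]|].
  have [T TS Tt] : mesh_union Th (row_of t) by rewrite -tO; exact: subset_closure.
  have [i iT Li] : exists2 i, i \in T & affine (G T i) (C T i) (row_of t) = 0.
    apply: contrapT => nL; apply: nV; rewrite -bigcup_seq.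
    exists T; first by rewrite /= mem_enum.
    split=> // i iT; rewrite lt_def.
    have simT := simplex_card TS; have indT := simplex_nondegenerate TS.
    move: Tt => /(conv_hullP simT indT (GC TS))/(_ i) ->.
    by rewrite andbT; apply/eqP => Li; apply: nL; exists i.
  exists (pickle (T, i)) => //; rewrite pickleK /= /H ifF//=.
  (* A zero slope would make the coordinate constant, but it is 0 at the given point and 1 at vertex
     i. *)
  apply/eqP => Gi; have := GC TS i iT; move: Li.
  rewrite /affine Gi edotC edot0r add0r => ->.
  by rewrite edotC edot0r add0r eqxx => /eqP; rewrite eq_sym oner_eq0.
apply: negligible_bigcup => k; case: unpickle => [Ti|]/=; last exact: negligible_set0.
rewrite /H; case: ifPn => [_|Gi]; first exact: negligible_set0.
by apply/negligibleP; [exact: measurable_hyperplane|exact: leb_hyperplane].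
Qed.

Variables (Omega : set 'rV[R]_d) (a : 'rV[R]_d -> R) (alpha0 alpha1 : R).
Hypotheses (oO : open Omega) (bO : bounded_set Omega) (tO : triangulates Th Omega).
Hypotheses (alpha0_gt0 : 0 < alpha0)
  (a_bounds : forall x, Omega x -> alpha0 <= a x <= alpha1).
Hypothesis aligned : aligned_discontinuities Th Omega a.

(** Alignment makes [a] continuous, hence measurable, on the open element; it is bounded there and
    the element has finite measure. *)
Lemma integrable_open_element T : T \in simplices Th ->
  (leb R d).-integrable (open_element Omega T) (EFin \o (a \o @row_of R d)).
Proof.
move=> TS; apply: measurable_bounded_integrable.
- exact: measurable_open_element.
- apply: le_lt_trans (leb_bounded bO oO); apply: le_measure; rewrite ?inE.
  + exact: measurable_open_element.
  + exact: measurable_preimage_row_of.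
  + by move=> t [].
- apply: measurable_fun_row_of; first exact: open_elementW.
  move=> x [Ox Ux]; apply: (aligned TS Ox).
  have := open_nbhs_nbhs (conj (@open_open_simplex _ _ _ T (G T) (C T)) Ux).
  apply: filterS.
  by apply: (open_simplex_sub _ _ (GC TS));
    [exact: simplex_card|exact: simplex_nondegenerate].
- exists alpha1; split; first exact: num_real.
  move=> M aM t [Ot _] /=; apply: le_trans (ltW aM).
  have /andP[a0 a1] := a_bounds Ot.
  by rewrite ger0_norm// (le_trans (ltW alpha0_gt0)).
Qed.

Variable phi : I -> 'rV[R]_d -> R.
Hypothesis phiG : forall T, T \in simplices Th ->
  forall i x, simplex T x -> phi i x = affine (G T i) (C T i) x.

Lemma grad_shape_function T i x : T \in simplices Th ->
  open_simplex T (G T) (C T) x -> grad (phi i) x = G T i.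
Proof.
move=> TS Tx; apply: (@grad_affine _ _ _ _ (C T i)).
have := open_nbhs_nbhs (conj (@open_open_simplex _ _ _ T (G T) (C T)) Tx).
apply: filterS => y Ty; apply: phiG => //.
by apply: (open_simplex_sub _ _ (GC TS)) => //;
    [exact: simplex_card|exact: simplex_nondegenerate].
Qed.

Definition element_mass T := \int[leb R d]_(t in open_element Omega T) a (row_of t).

Lemma element_mass_ge0 T : 0 <= element_mass T.
Proof.
apply: Rintegral_ge0 => t [Ot _]; have /andP[a0 _] := a_bounds Ot.
exact: le_trans (ltW alpha0_gt0) a0.
Qed.

(** The null skeleton is dropped, the rest of [Omega] splits into disjoint open elements, and on
    each of them the gradients are constants that leave the integral. *)
Lemma stiffness_assembly i j : stiffness Omega a phi i j =
  \sum_(T in simplices Th) element_mass T * edot (G T j) (G T i).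
Proof.
have gradE T x : T \in simplices Th -> open_simplex T (G T) (C T) (row_of x) ->
    a (row_of x) * edot (grad (phi j) (row_of x)) (grad (phi i) (row_of x)) =
    a (row_of x) * edot (G T j) (G T i).
  by move=> TS Tx; rewrite !(grad_shape_function _ TS).
rewrite mxE /int_Rd {1}/Rintegral.
rewrite (integral_setD_null _ _ (measurable_mesh_skeleton oO)); last first.
  exact: leb_mesh_skeleton.
rewrite -/(Rintegral _ _ _) (_ : _ `\` _ =
    \big[setU/set0]_(T <- enum (simplices Th)) open_element Omega T); last first.
  rewrite setDD; apply/setIidr; rewrite -bigcup_seq => t [T _ []]//.
rewrite Rintegral_bigsetU.
- rewrite big_enum/=; apply: eq_bigr => T TS; rewrite -RintegralZr//.
  + by apply: eq_Rintegral => t; rewrite inE => -[_ /gradE]; exact.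
  + exact: measurable_open_element.
  + exact: integrable_open_element.
- exact: measurable_open_element.
- exact: enum_uniq.
- move=> T T'; rewrite /= !mem_enum => TS TS' [t [[_ tT] [_ tT']]].
  exact: open_simplex_disjoint tT tT'.
- move=> T; rewrite mem_enum => TS.
  apply: (@eq_integrable _ _ _ _ _ _ (fun t =>
    (EFin \o (a \o @row_of R d)) t * (edot (G T j) (G T i))%:E)%E).
  + exact: measurable_open_element.
  + by move=> t; rewrite inE => -[_ /gradE] E; rewrite /= E.
  + by apply: integrableZr;
      [exact: measurable_open_element|exact: integrable_open_element].
Qed.

End ShapeFunctions.

End Assembly.

(** * Quadratic forms of the stiffness matrix and of its positive part *)

Section Forms.
Variables (R : realType) (n : nat).
Implicit Types (M : 'M[R]_n) (u v : 'cV[R]_n).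

Lemma ipE M u v : ip M u v = \sum_i \sum_j M i j * u j 0 * v i 0.
Proof. by apply: eq_bigr => i _; rewrite mxE mulr_suml. Qed.

Lemma mulmx_delta M i j : (M *m delta_mx j (0 : 'I_1)) i 0 = M i j.
Proof. by rewrite -colE mxE. Qed.

Lemma ip_delta M u i : ip M u (delta_mx i 0) = (M *m u) i 0.
Proof.
rewrite /ip (bigD1 i)//= [X in _ * X]mxE !eqxx mulr1 big1 ?addr0// => j ji.
by rewrite [X in _ * X]mxE (negbTE ji) mulr0.
Qed.

Lemma sqnorm_diag M v : sqnorm (diag_part M) v = \sum_i M i i * v i 0 ^+ 2.
Proof. by apply: eq_bigr => i _; rewrite mul_diag_mx !mxE expr2 mulrA. Qed.

(** Expanding the square, the pure squares cancel by the zero row and column sums; only the cross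
    terms remain. *)
Lemma laplacian_sqnorm M u : M^T = M -> (forall i, \sum_j M i j = 0) ->
  \sum_i \sum_j M i j * (u i 0 - u j 0) ^+ 2 = - 2 * sqnorm M u.
Proof.
move=> sM M0; have M0' j : \sum_i M i j = 0.
  by rewrite -[RHS](M0 j); apply: eq_bigr => i _; rewrite -{1}sM mxE.
transitivity (\sum_i \sum_j (M i j * u i 0 ^+ 2 + M i j * u j 0 ^+ 2
                             + - 2 * (M i j * u j 0 * u i 0))).
  by apply: eq_bigr => i _; apply: eq_bigr => j _; ring.
under eq_bigr do rewrite !big_split/= -mulr_suml M0 mul0r add0r -mulr_sumr.
rewrite big_split/= exchange_big/= big1 ?add0r => [|j _]; last first.
  by rewrite -mulr_suml M0' mul0r.
by rewrite -mulr_sumr -ipE.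
Qed.

(** Links [Aplus_form], where an edge is counted once, to sums over all ordered pairs. *)
Lemma sum_ordered_pairs (E : rel 'I_n) (F : 'I_n -> 'I_n -> R) :
    symmetric E -> irreflexive E -> (forall i j, F i j = F j i) ->
  \sum_i \sum_(j | E i j) F i j =
  2 * \sum_(i < n) \sum_(j < n | (i < j)%N && E i j) F i j.
Proof.
move=> sE iE sF.
transitivity (\sum_(i < n) (\sum_(j < n | (i < j)%N && E i j) F i j +
                             \sum_(j < n | (j < i)%N && E i j) F i j)).
  apply: eq_bigr => i _; rewrite (bigID (fun j : 'I_n => (i < j)%N))/=; congr (_ + _).
    by apply: eq_bigl => j; rewrite andbC.
  apply: eq_bigl => j; rewrite -leqNgt leq_eqVlt andbC.
  by have [/val_inj->|] := eqVneq (val j) (val i); rewrite /= ?iE ?andbF.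
rewrite big_split/= mulr2n mulrDl mul1r; congr (_ + _).
rewrite (exchange_big_dep predT)//=; apply: eq_bigr => i _.
by apply: eq_big => [j|j _]; [rewrite sE|rewrite sF].
Qed.

End Forms.

(** * Sign structure of the form over positive edges *)

Section Mesh.
Variables (R : realType) (d : nat) (Th : mesh R d).
Implicit Types (u v : 'cV[R]_(nv Th)).
Variable A : 'M[R]_(nv Th).

Lemma edge_sym : symmetric (@edge _ _ Th).
Proof.
move=> i j; rewrite /edge eq_sym; congr (_ && _).
by apply: eq_existsb => T; rewrite [(j \in T) && _]andbC.
Qed.

Lemma EplusE i j : Eplus A i j = edge i j && (A i j < 0).
Proof. by rewrite /Eplus /Eminus ltNge; case: (edge i j). Qed.

Lemma Aplus_formC u v : Aplus_form A u v = Aplus_form A v u.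
Proof.
by apply: eq_bigr => i _; apply: eq_bigr => j _; rewrite mulrAC.
Qed.

Lemma Aplus_sym : (Aplus A)^T = Aplus A.
Proof. by apply/matrixP => i j; rewrite !mxE Aplus_formC. Qed.

(** Each edge contributes its positive weight times the product of the differences of two distinct
    coordinate vectors across it, which is 0 or -1. *)
Lemma Aplus_offdiag i j : i != j -> Aplus A i j <= 0.
Proof.
move=> ij; rewrite mxE; apply: sumr_le0 => k _; apply: sumr_le0 => l.
rewrite EplusE => /and3P[/ltn_eqF/negbT kl _ Akl]; rewrite -mulrA.
rewrite mulr_ge0_le0 ?oppr_ge0 ?(ltW Akl)// !mxE !andbT.
have {}kl : k != l by rewrite -val_eqE kl.
case: (eqVneq k j) => [kj|_]; case: (eqVneq l j) => [lj|_];
  case: (eqVneq k i) => [ki|_]; case: (eqVneq l i) => [li|_];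
  rewrite ?subrr ?subr0 ?sub0r ?mulr0 ?mul0r ?mulr1 ?mul1r ?oppr_le0 ?ler01//;
  by subst; move: ij kl; rewrite ?eqxx.
Qed.

Lemma Aplus_ge0 u : 0 <= sqnorm (Aplus A) u.
Proof.
rewrite /sqnorm AplusE; apply: sumr_ge0 => k _; apply: sumr_ge0 => l.
rewrite EplusE => /and3P[_ _ Akl].
by rewrite -mulrA mulr_ge0 ?oppr_ge0 ?(ltW Akl)// -expr2 sqr_ge0.
Qed.

Lemma sqnorm_delta (M : 'M[R]_(nv Th)) i : sqnorm M (delta_mx i 0) = M i i.
Proof. by rewrite /sqnorm ip_delta mulmx_delta. Qed.

Lemma Aplus_form_const u : (forall i j, Eplus A i j -> u i 0 = u j 0) ->
  sqnorm (Aplus A) u = 0.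
Proof.
move=> uE; rewrite /sqnorm AplusE; apply: big1 => i _; apply: big1 => j.
by move=> /andP[_ /uE->]; rewrite subrr !mulr0.
Qed.

End Mesh.

(** * Element energies and the lower bound *)

Section Energy.
Variables (R : realType) (d : nat) (Th : mesh R d).
Implicit Types (u v : 'cV[R]_(nv Th)).
Local Notation I := 'I_(nv Th).
Variables (G : {set I} -> I -> 'rV[R]_d) (C : {set I} -> I -> R).
Hypothesis GC : shape_functions G C.
Variable m : {set I} -> R.
Hypothesis m_ge0 : forall T, 0 <= m T.
Variable A : 'M[R]_(nv Th).
Hypothesis assembly : forall i j,
  A i j = \sum_(T in simplices Th) m T * edot (G T j) (G T i).

Definition interpolant_gradient u T := \sum_k u k 0 *: G T k.

Lemma ip_energy u v : ip A u v =
  \sum_(T in simplices Th) m T *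
    edot (interpolant_gradient u T) (interpolant_gradient v T).
Proof.
rewrite ipE; under eq_bigr do under eq_bigr do rewrite assembly !mulr_suml.
under eq_bigr do rewrite exchange_big/=.
rewrite exchange_big/=; apply: eq_bigr => T _.
rewrite edot_sumr mulr_sumr; apply: eq_bigr => i _.
rewrite edotZr edotC edot_sumr !mulr_sumr; apply: eq_bigr => j _.
by rewrite edotZr [edot (G T i) _]edotC; ring.
Qed.

Lemma stiffness_sym : A^T = A.
Proof.
by apply/matrixP => i j; rewrite mxE !assembly; apply: eq_bigr => T _; rewrite edotC.
Qed.

Lemma stiffness_row_sum i : \sum_j A i j = 0.
Proof.
under eq_bigr do rewrite assembly; rewrite exchange_big/= big1// => T TS.
rewrite -mulr_sumr; under eq_bigr do rewrite edotC; rewrite -edot_sumr.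
rewrite (sum_gradient (simplex_card TS) (simplex_nondegenerate TS) (GC TS)).
by rewrite edot0r mulr0.
Qed.

Lemma stiffness_not_edge i j : i != j -> ~~ edge i j -> A i j = 0.
Proof.
move=> ij; rewrite /edge ij/= => /existsPn ijT; rewrite assembly big1// => T TS.
have gout := gradient_outside (simplex_card TS) (simplex_nondegenerate TS) (GC TS).
have := ijT T; rewrite TS/= negb_and => /orP[/gout->|/gout->].
  by rewrite edot0r mulr0.
by rewrite edotC edot0r mulr0.
Qed.

Lemma sqnorm_ge0 u : 0 <= sqnorm A u.
Proof.
by rewrite /sqnorm ip_energy sumr_ge0// => T _; rewrite mulr_ge0 ?edot_ge0.
Qed.

(** Only [0 <= m T] is known, so on each T either the mass or the gradient of u vanishes; in both
    cases T contributes nothing to [A *m u]. *)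
Lemma sqnorm_eq0 u : sqnorm A u = 0 -> A *m u = 0.
Proof.
rewrite /sqnorm ip_energy => /psumr_eq0P u0.
apply/colP => i; rewrite [RHS]mxE -ip_delta ip_energy big1// => T TS.
have /eqP : m T * edot (interpolant_gradient u T) (interpolant_gradient u T) = 0.
  by apply: u0 => // *; rewrite mulr_ge0 ?edot_ge0.
rewrite mulf_eq0 edot_eq0 => /orP[/eqP->|/eqP->]; first by rewrite mul0r.
by rewrite edotC edot0r mulr0.
Qed.

Lemma Eplus_sym : symmetric (Eplus A).
Proof. by move=> i j; rewrite !EplusE edge_sym -{1}stiffness_sym mxE. Qed.

(** Both forms are half a sum over ordered pairs of squared differences with weights [- A i j];
    subtracting leaves the pairs outside E^+. *)
Lemma Aplus_sub u : 2 * (sqnorm (Aplus A) u - sqnorm A u) =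
  \sum_i \sum_(j | ~~ Eplus A i j) A i j * (u i 0 - u j 0) ^+ 2.
Proof.
rewrite mulrBr /sqnorm AplusE.
have irrE : irreflexive (Eplus A) by move=> i; rewrite EplusE /edge eqxx.
have := laplacian_sqnorm u stiffness_sym stiffness_row_sum; rewrite /sqnorm => lap.
rewrite -sum_ordered_pairs //; last 2 first.
- exact: Eplus_sym.
- by move=> i j; rewrite -{1}stiffness_sym mxE; ring.
rewrite -mulNr -lap -big_split/=; apply: eq_bigr => i _.
rewrite [X in _ + X](bigID (Eplus A i))/= addrA -big_split/= big1 ?add0r// => j _.
by ring.
Qed.

(** Outside E^+ no pair contributes negatively: the difference vanishes on the diagonal, the entry
    vanishes off the edges, and on E^- it is nonnegative. *)
Lemma stiffness_le_Aplus u : sqnorm A u <= sqnorm (Aplus A) u.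
Proof.
rewrite -subr_ge0 -(pmulr_rge0 _ (ltr0n R 2)) Aplus_sub.
apply: sumr_ge0 => i _; apply: sumr_ge0 => j.
rewrite EplusE negb_and -leNgt; have [->|ij] := eqVneq i j.
  by rewrite subrr expr0n mulr0.
case/orP => [/(stiffness_not_edge ij)->|Aij]; first by rewrite mul0r.
by rewrite mulr_ge0 ?sqr_ge0.
Qed.

(** * Upper bound from shape regularity *)

Section ShapeRegular.
Variable sigma : R.
Hypotheses (sigma_ge0 : 0 <= sigma) (regular : shape_regular Th sigma).

Lemma gradient_edge_le T i j k : T \in simplices Th -> i \in T -> j \in T ->
  enorm (G T k) * enorm (@vtx _ _ Th i - @vtx _ _ Th j) <= sigma.
Proof.
move=> TS iT jT; have [_ _ diamT] := regular TS.
have simT := simplex_card TS; have indT := simplex_nondegenerate TS.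
apply: (@le_trans _ _ (enorm (G T k) * (sigma * in_diam (simplex T)))).
  apply: ler_wpM2l; first exact: enorm_ge0.
  exact: le_trans (edge_le_diam simT indT (GC TS) iT jT) diamT.
rewrite mulrCA -[leRHS]mulr1; apply: ler_wpM2l => //.
by have := gradient_in_diam simT indT (GC TS) k.
Qed.

(** The nodal difference is (D, e), with e the edge vector. Cauchy-Schwarz, used twice, gives the
    bound |g_j| |g_i| |D|^2 |e|^2, and each product |g| |e| is at most sigma. *)
Lemma local_edge_energy u T i j : T \in simplices Th -> i \in T -> j \in T ->
  edot (G T j) (G T i) * (u i 0 - u j 0) ^+ 2 <=
  sigma ^+ 2 * edot (interpolant_gradient u T) (interpolant_gradient u T).
Proof.
move=> TS iT jT.
set D := interpolant_gradient u T; set e := @vtx _ _ Th i - @vtx _ _ Th j.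
rewrite -(gradient_combination (GC TS) (fun k => u k 0) iT jT) -/D -/e.
apply: (@le_trans _ _ (enorm (G T j) * enorm (G T i) * edot D e ^+ 2)).
  apply: ler_wpM2r; first exact: sqr_ge0.
  apply: le_trans (ler_norm _) _.
  rewrite -ler_sqr ?nnegrE ?mulr_ge0 ?enorm_ge0// real_normK ?num_real//.
  by rewrite exprMn !enorm_sqr edot_sqr_le.
apply: (@le_trans _ _ (enorm (G T j) * enorm (G T i) * (edot D D * edot e e))).
  by apply: ler_wpM2l; rewrite ?mulr_ge0 ?enorm_ge0// edot_sqr_le.
rewrite -(enorm_sqr e) expr2 mulrCA mulrC; apply: ler_wpM2r; first exact: edot_ge0.
rewrite mulrACA; apply: ler_pM; rewrite ?mulr_ge0 ?enorm_ge0//;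
  exact: gradient_edge_le.
Qed.

Lemma edge_energy u i j : A i j * (u i 0 - u j 0) ^+ 2 <=
  \sum_(T in simplices Th) ((i \in T) && (j \in T))%:R *
    (sigma ^+ 2 * (m T * edot (interpolant_gradient u T) (interpolant_gradient u T))).
Proof.
rewrite assembly mulr_suml; apply: ler_sum => T TS.
have simT := simplex_card TS; have indT := simplex_nondegenerate TS.
have gout := gradient_outside simT indT (GC TS).
have [iT|/gout->] := boolP (i \in T); last by rewrite edot0r mulr0 !mul0r.
have [jT|/gout->] := boolP (j \in T); last by rewrite edotC edot0r mulr0 !mul0r.
rewrite mul1r [leRHS]mulrCA -[leLHS]mulrA.
by apply: ler_wpM2l => //; exact: local_edge_energy.
Qed.

Lemma Aplus_le_stiffness u :
  sqnorm (Aplus A) u <= (1 + d.+1%:R ^+ 2 * sigma ^+ 2) * sqnorm A u.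
Proof.
rewrite mulrDl mul1r -lerBlDl.
(* The difference is nonnegative, so it may be doubled to match the ordered pairs of [Aplus_sub]. *)
apply: (@le_trans _ _ (2 * (sqnorm (Aplus A) u - sqnorm A u))).
  rewrite ler_peMl ?ler1n// subr_ge0; exact: stiffness_le_Aplus.
rewrite Aplus_sub.
(* The edge bounds are nonnegative, so the sum may run over all ordered pairs; exchanging sums then
   counts the (d+1)^2 pairs of vertices of each simplex. *)
apply: (@le_trans _ _ (\sum_i \sum_j \sum_(T in simplices Th) ((i \in T) && (j \in T))%:R *
    (sigma ^+ 2 * (m T * edot (interpolant_gradient u T) (interpolant_gradient u T))))).
  apply: ler_sum => i _; rewrite big_mkcond/=; apply: ler_sum => j _.
  case: ifP => _; first exact: edge_energy.
  by apply: sumr_ge0 => T _; rewrite mulr_ge0 ?mulr_ge0 ?sqr_ge0 ?edot_ge0.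
under eq_bigr do rewrite exchange_big/=.
rewrite exchange_big/= /sqnorm ip_energy mulr_sumr; apply: ler_sum => T TS.
under eq_bigr do rewrite -mulr_suml.
rewrite -mulr_suml mulrA; apply: ler_wpM2r; first by rewrite mulr_ge0 ?edot_ge0.
apply: ler_wpM2r; first exact: sqr_ge0.
have cardTR : \sum_i (i \in T)%:R = d.+1%:R :> R.
  rewrite -(simplex_card TS) -natr_sum -sum1_card; congr (_%:R).
  by rewrite [RHS]big_mkcond; apply: eq_bigr => k _; case: ifP.
under eq_bigr do under eq_bigr do rewrite -mulnb natrM.
by under eq_bigr do rewrite -mulr_sumr; rewrite -mulr_suml cardTR expr2.
Qed.

End ShapeRegular.

(** * Positive diagonal and connectivity *)

Hypothesis null_space : null_space_is_constants A.

Lemma sqnorm_le0_const u : sqnorm A u <= 0 -> exists c, u = const_mx c.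
Proof.
move=> u0; apply/null_space/sqnorm_eq0/eqP.
by rewrite eq_le u0 sqnorm_ge0.
Qed.

(** The entry is the energy of a coordinate vector. If it were not positive, that vector would be
    constant, yet for d > 0 a simplex at i has a second vertex. *)
Lemma stiffness_diag_gt0 i : (0 < d)%N -> 0 < A i i.
Proof.
move=> d0; rewrite -sqnorm_delta ltNge; apply/negP => /sqnorm_le0_const[c /colP ec].
have [T TS iT] := vtx_covered i.
have /card_gt0P[j] : (0 < #|T :\ i|)%N.
  by have := cardsD1 i T; rewrite iT (simplex_card TS) add1n => -[<-].
rewrite !inE => /andP[ji _].
have := ec i; have := ec j; rewrite !mxE !eqxx (negbTE ji)/= => <- /eqP.
by rewrite oner_eq0.
Qed.

Lemma Aplus_connected i j : connect (Eplus A) i j.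
Proof.
pose u : 'cV[R]_(nv Th) := \col_k (connect (Eplus A) i k)%:R.
have u0 : sqnorm (Aplus A) u = 0.
  apply: Aplus_form_const => k l kl; rewrite !mxE; congr (_%:R); congr (nat_of_bool _).
  by apply: same_connect_r; [exact: sym_connect_sym Eplus_sym|exact: connect1].
have [c /colP uc] : exists c, u = const_mx c.
  by apply: sqnorm_le0_const; rewrite -u0 stiffness_le_Aplus.
have := uc j; have := uc i; rewrite !mxE connect0 => <- /eqP.
by case: connect => //; rewrite eq_sym oner_eq0.
Qed.

End Energy.

Theorem theorem5p1 (R : realType) (sigma : R) (sigma_ge1 : 1 <= sigma) :
  exists c1 c2 C C' : R, [/\ 0 < c1, 0 < c2, 0 < C & 0 < C'] /\
  forall (d : nat) (Omega : set 'rV[R]_d) (Th : mesh R d)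
      (a : 'rV[R]_d -> R) (alpha0 alpha1 : R)
      (phi : 'I_(nv Th) -> 'rV[R]_d -> R),
    (1 <= d <= 3)%N ->
    open Omega -> connected Omega -> bounded_set Omega ->
    triangulates Th Omega ->
    shape_regular Th sigma ->
    0 < alpha0 -> 0 < alpha1 ->
    (forall x, Omega x -> alpha0 <= a x <= alpha1) ->
    aligned_discontinuities Th Omega a ->
    nodal_basis phi ->
    let A := stiffness Omega a phi in
    null_space_is_constants A ->
    [/\ Mmatrix_relative C C' A (Aplus A),
        forall u : 'cV[R]_(nv Th),
          c1 * sqnorm A u <= sqnorm (Aplus A) u <= c2 * sqnorm A u
      & forall i j : 'I_(nv Th), connect (Eplus A) i j].
Proof.
have sigma0 : 0 <= sigma by exact: le_trans ler01 sigma_ge1.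
(* The constants are fixed before d, so 4 stands for the largest d+1, reached at d = 3. *)
pose K := 1 + 4 ^+ 2 * sigma ^+ 2; exists 1, K, K, 1; split.
  by have K0 : 0 < K by rewrite ltr_pwDl ?mulr_ge0 ?sqr_ge0.
move=> d Omega Th a alpha0 alpha1 phi /andP[d_gt0 d_le3] oO _ bO tO regular.
move=> alpha0_gt0 _ a_bounds aligned nphi A null_space.
have [G [C [GC phiG]]] := nodal_basis_shape_functions nphi.
pose m := element_mass G C Omega a.
have m_ge0 T : 0 <= m T by exact: element_mass_ge0 alpha0_gt0 a_bounds _.
have assembly i j : A i j = \sum_(T in simplices Th) m T * edot (G T j) (G T i).
  exact: (stiffness_assembly GC oO bO tO alpha0_gt0 a_bounds aligned phiG).
have le_Aplus u : sqnorm A u <= sqnorm (Aplus A) u.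
  exact: (stiffness_le_Aplus GC assembly).
have Aplus_le u : sqnorm (Aplus A) u <= K * sqnorm A u.
  apply: le_trans (Aplus_le_stiffness GC m_ge0 assembly sigma0 regular u) _.
  apply: ler_wpM2r; first exact: (sqnorm_ge0 m_ge0 assembly).
  rewrite lerD2l ler_wpM2r ?sqr_ge0// ler_sqr ?nnegrE ?ler0n//.
  by rewrite ler_nat.
split; last exact: (Aplus_connected GC m_ge0 assembly null_space).
  split=> [|//|v]; last first.
    (* Diagonal entries are energies of coordinate vectors, so [le_Aplus] compares them with
       constant 1. *)
    rewrite mul1r !sqnorm_diag; apply: ler_sum => i _.
    by rewrite ler_wpM2r ?sqr_ge0// -!sqnorm_delta.
  split; [exact: Aplus_sym| |exact: Aplus_offdiag|exact: Aplus_ge0].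
  move=> i; rewrite -sqnorm_delta; apply: lt_le_trans (le_Aplus _).
  by rewrite sqnorm_delta; exact: (stiffness_diag_gt0 m_ge0 assembly null_space).
by move=> u; rewrite mul1r le_Aplus Aplus_le.
Qed.
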